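(* Let $d\ge 2$ be an integer, and let $T_d(x)$ be the normalized Chebyshev polynomial of degree $d$. Then for $a\in\mathbb{Z}$, the pair $(T_d(x),a)$ is dynamically monogenic (over $\mathbb{Q}$) if and only if all of the following hold: (i) For all primes $p$ not dividing $d$, one has $a\not\equiv\pm 2\bmod p^2$. (ii) For all primes $p\mid d$, one has $T_p(a)\not\equiv a\bmod p^2$.
   Context: The normalized Chebyshev polynomials $T_d(x)\in\mathbb{Z}[x]$ are defined by $T_0(x)=2$, $T_1(x)=x$, and $T_{d+1}(x)=xT_d(x)-T_{d-1}(x)$. A monic polynomial in $\mathbb{Z}[x]$ is monogenic if it is irreducible over $\mathbb{Q}$ and, for a root $\alpha$, $\mathbb{Z}[\alpha]$ is the full ring of integers of $\mathbb{Q}(\alpha)$. For $f(x)\in\mathbb{Z}[x]$ monic and $a\in\mathbb{Z}$, the pair $(f(x),a)$ is dynamically monogenic if $f^n(x)-a$ is monogenic for every $n\ge1$, where $f^n$ is the $n$-fold composition of $f$. *)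

(* Defs.v *)
From mathcomp Require Import all_boot all_order all_algebra all_field.

Set Implicit Arguments.
Unset Strict Implicit.
Unset Printing Implicit Defensive.

Import Order.TTheory GRing.Theory Num.Theory.
Local Open Scope ring_scope.

Fixpoint chebyshevT (d : nat) : {poly int} :=
  match d with
  | 0 => 2%:P
  | 1 => 'X
  | (d'.+1 as d1).+1 => 'X * chebyshevT d1 - chebyshevT d'
  end.

(* The field Q(alpha); x / 0 = 0, so the denominator needs no condition. *)
Definition in_Q_adjoin (alpha x : algC) : Prop :=
  exists p q : {poly rat},
    x = (map_poly ratr p).[alpha] / (map_poly ratr q).[alpha].

Definition in_ring_of_integers (alpha x : algC) : Prop :=
  in_Q_adjoin alpha x /\ x \in Aint.

Definition in_Z_adjoin (alpha x : algC) : Prop :=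
  exists p : {poly int}, x = (map_poly intr p).[alpha].

(* Irreducibility makes all roots conjugate, so quantifying over every root
   agrees with choosing one; algC is algebraically closed, so there is one. *)
Definition monogenic (f : {poly int}) : Prop :=
  [/\ f \is monic,
      irreducible_poly (map_poly intr f : {poly rat}) &
      forall alpha : algC, root (map_poly intr f) alpha ->
        forall x : algC, in_Z_adjoin alpha x <-> in_ring_of_integers alpha x].

Definition poly_iter (f : {poly int}) (n : nat) : {poly int} :=
  iter n (fun g => f \Po g) 'X.

Definition dynamically_monogenic (f : {poly int}) (a : int) : Prop :=
  forall n : nat, (1 <= n)%N -> monogenic (poly_iter f n - a%:P).

(* Main.v *)
Require Import Defs.
From mathcomp Require Import all_boot all_order all_algebra all_field.
From mathcomp Require Import ring.

Set Implicit Arguments.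
Unset Strict Implicit.
Unset Printing Implicit Defensive.

Import Order.TTheory GRing.Theory Num.Theory.
Local Open Scope ring_scope.

(** Iterates of Chebyshev polynomials are Chebyshev polynomials, since [T_m \Po
    T_n = T_(m n)]; so the question is when all the [T_N - a] with [N = d ^ n]
    are monogenic.

    For a prime [p], [T_p] is congruent to ['X^p] modulo [p]: its derivative is
    [p U_p], which kills all middle coefficients modulo [p], and its value at
    [2] is [2]. So [T_(p^k) - a] is congruent to [('X - a)^(p^k)], and if
    [T_p(a)] differs from [a] modulo [p^2], then [T_(p^k) - a] is an Eisenstein
    polynomial in ['X - a] ([chebyshevT_eisenstein]). A root of [T_N - a]
    generates a field containing a root of [T_(p^k) - a] for each prime power
    [p^k] exactly dividing [N], so its degree is divisible by [N], and [T_N - a]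
    is irreducible ([chebyshevT_irreducible]).

    Whether [Z[theta]] is the ring of integers is decided one prime at a time by
    the criterion of Dedekind, in the form due to Uchida: for a monic
    irreducible [f], [Z[theta]] has index prime to [p] as soon as [f] lies in
    the square of no maximal ideal [(p, phi)] of [Z[X]] ([dedekind_p_maximal],
    [monogenic_of_dedekind]). If [p] divides [N], then [T_N - a] is [G ^ p + p
    V] with [G = T_(N/p) - a], and [V] is congruent modulo [G] to [(T_p(a) - a)
    / p], a unit modulo [p] ([chebyshevT_dedekind_dvd]). If [p] does not divide
    [N], then the Pell equation [T_N^2 - 4 = ('X^2 - 4) U_N^2] and [T_N' = N
    U_N] show that [T_N - a] is separable modulo [p] unless [a] is congruent to
    [2 e] modulo [p] with [e = 1] or [e = -1]. In that case one has [T_N - 2 e =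
    R Q^2] with [R] squarefree modulo [p], so that [T_N - a] is [R Q^2] plus [p]
    times a unit modulo [p] ([chebyshevT_dedekind_ndvd]).

    Conversely, the same expansions produce an algebraic integer outside
    [Z[theta]] when a congruence holds modulo [p^2]: the element [(R Q)(theta) /
    p] of [not_monogenic_of_square_part] and the element [g(theta) / p], where
    [T_N - a = G g + p v], of [not_monogenic_of_prime_expansion]. *)

Local Notation red p := (map_poly (intr : int -> 'F_p)).
Local Notation T := chebyshevT.

(** * Chebyshev polynomials of both kinds *)

(** Shifted by one from the usual indexing, [chebyshevU n] having degree [n -
    1]: this makes [T_n' = n U_n] and the Pell equation free of index shifts. *)
Fixpoint chebyshevU (n : nat) : {poly int} :=
  match n with
  | 0 => 0
  | 1 => 1
  | (n'.+1 as n1).+1 => 'X * chebyshevU n1 - chebyshevU n'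
  end.

Local Notation U := chebyshevU.

Lemma chebyshevTSS n : T n.+2 = 'X * T n.+1 - T n. Proof. by []. Qed.

Lemma chebyshevUSS n : U n.+2 = 'X * U n.+1 - U n. Proof. by []. Qed.

Lemma chebyshevT_U n :
  T n = 2%:R * U n.+1 - 'X * U n /\ T n.+1 = 'X * U n.+1 - 2%:R * U n.
Proof.
elim: n => [|n [IH1 IH2]].
  by rewrite /= polyCMn; split; ring.
by split; rewrite ?chebyshevTSS ?IH1 ?IH2 chebyshevUSS; ring.
Qed.

(** The norm form of the recurrence is invariant along it; all the quadratic
    identities below reduce to this one by expressing [T] through [U]. *)
Lemma chebyshevU_cassini n :
  U n.+1 ^+ 2 - 'X * U n * U n.+1 + U n ^+ 2 = 1.
Proof.
elim: n => [|n IH]; first by rewrite /=; ring.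
by rewrite -[RHS]IH chebyshevUSS; ring.
Qed.

Lemma chebyshevT_cassini n :
  T n.+1 ^+ 2 - 'X * T n * T n.+1 + T n ^+ 2 = 4%:R - 'X ^+ 2.
Proof.
have [-> ->] := chebyshevT_U n.
transitivity ((4%:R - 'X ^+ 2) * (U n.+1 ^+ 2 - 'X * U n * U n.+1 + U n ^+ 2)).
  by ring.
by rewrite chebyshevU_cassini mulr1.
Qed.

Lemma chebyshevT_pell n : T n ^+ 2 - 4%:R = ('X ^+ 2 - 4%:R) * U n ^+ 2.
Proof.
have [-> _] := chebyshevT_U n.
transitivity ((2%:R * U n.+1 - 'X * U n) ^+ 2
  - 4%:R * (U n.+1 ^+ 2 - 'X * U n * U n.+1 + U n ^+ 2)); last by ring.
by rewrite chebyshevU_cassini mulr1.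
Qed.

Lemma chebyshevT_double n :
  T n.*2 = T n ^+ 2 - 2%:R /\ T n.*2.+1 = T n * T n.+1 - 'X.
Proof.
elim: n => [|n [IH1 IH2]].
  by rewrite /= polyCMn; split; ring.
have e1 : T n.+1.*2 = T n.+1 ^+ 2 - 2%:R.
  rewrite doubleS chebyshevTSS IH1 IH2.
  transitivity (T n.+1 ^+ 2 - (T n.+1 ^+ 2 - 'X * T n * T n.+1 + T n ^+ 2)
     + 2%:R - 'X ^+ 2); first by ring.
  by rewrite chebyshevT_cassini; ring.
split=> //.
rewrite doubleS chebyshevTSS -doubleS e1 IH2 chebyshevTSS; ring.
Qed.

(** Both sides satisfy, as sequences in [m], the recurrence with multiplier [T
    n]; for the right-hand side this is the addition formula [add]. *)
Lemma chebyshevT_comp m n : T m \Po T n = T (m * n).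
Proof.
have add k l : T (l + k.*2) = T k * T (l + k) - T l.
  have [d1 d2] := chebyshevT_double k.
  elim/ltn_ind: l => -[|[|l]] IH.
  - by rewrite !add0n d1 /= polyCMn; ring.
  - by rewrite !add1n d2.
  rewrite !addSn !chebyshevTSS -!addSn !IH // !addSn; ring.
elim/ltn_ind: m => -[|[|m]] IH.
- by rewrite mul0n /= comp_polyC.
- by rewrite mul1n comp_polyX.
rewrite chebyshevTSS comp_polyB comp_polyM comp_polyX !IH //.
by rewrite !mulSn addnA addnn [(n.*2 + _)%N]addnC add addnC.
Qed.

Lemma poly_iter_chebyshevT d n : poly_iter (T d) n = T (d ^ n).
Proof.
elim: n => [|n IH] //.
by rewrite /poly_iter iterS -/(poly_iter _ n) IH chebyshevT_comp expnS.
Qed.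

Lemma chebyshevT_deriv n : (T n)^`() = n%:R * U n.
Proof.
elim/ltn_ind: n => -[|[|n]] IH.
- by rewrite /= !derivC; ring.
- by rewrite /= derivX -[1]/(1%:P); ring.
rewrite chebyshevTSS chebyshevUSS derivB derivM derivX (IH n) // (IH n.+1) //.
by have [_ ->] := chebyshevT_U n; ring.
Qed.

Lemma chebyshevT_2 n : (T n).[2] = 2.
Proof.
elim/ltn_ind: n => -[|[|n]] IH; rewrite ?chebyshevTSS ?hornerE //.
by rewrite !IH //; ring.
Qed.

Lemma chebyshevT_size_monic n : size (T n.+1) = n.+2 /\ T n.+1 \is monic.
Proof.
elim/ltn_ind: n => -[|n] IH; first by rewrite size_polyX monicX.
have [s1 m1] := IH n (leqnn _).
have s0 : (size (T n) <= n.+1)%N.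
  case: n IH {s1 m1} => [|n] IH; first exact: size_polyC_leq1.
  by have [-> _] := IH n (leqnSn _).
have sX : size ('X * T n.+1)%R = n.+3.
  by rewrite mulrC size_mulX ?s1 // -size_poly_gt0 s1.
have lt : (size (- T n)%R < size ('X * T n.+1)%R)%N.
  by rewrite size_polyN sX ltnS (leq_trans s0).
rewrite chebyshevTSS size_polyDl // sX; split=> //.
by rewrite monicE lead_coefDl // lead_coefM lead_coefX mul1r -monicE.
Qed.

Lemma size_monic_chebyshevT_sub n (a : int) : (0 < n)%N ->
  size (T n - a%:P) = n.+1 /\ T n - a%:P \is monic.
Proof.
case: n => // n _; have [sT mT] := chebyshevT_size_monic n.
have lta : (size (- (a%:P : {poly int})) < size (T n.+1))%N.
  by rewrite size_polyN sT (leq_ltn_trans (size_polyC_leq1 _)).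
by split; rewrite ?size_polyDl // monicE lead_coefDl // -monicE.
Qed.

(** With ['X = y + 1/y], [T_n - 2 e] is the square of [y^(n/2) - e y^(-n/2)] for
    [e = 1] or [e = -1]. The factor [R] collects the few factors of ['X^2 - 4]
    needed to make the cofactor a square of a polynomial in ['X]. *)
Lemma chebyshevT_square_part n (e : int) : e ^+ 2 = 1 ->
  exists R Q : {poly int}, [/\ T n - (2 * e)%:P = R * Q ^+ 2,
    exists S, R * S = 'X ^+ 2 - 4%:P & (odd n -> R = 'X - (2 * e)%:P)].
Proof.
move=> he; have e2P : e%:P ^+ 2 = 1 :> {poly int} by rewrite -rmorphXn he.
have P2 : (2%:P : {poly int}) = 2%:R by rewrite polyCMn.
have P4 : (4%:P : {poly int}) = 4%:R by rewrite polyCMn.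
rewrite polyCM P2 P4 -(odd_double_half n); set k := n./2.
have [d1 d2] := chebyshevT_double k.
case: (odd n); rewrite ?(add0n, add1n) ?oddS odd_double.
  exists ('X - 2%:R * e%:P), (U k.+1 + e%:P * U k); split=> //; last first.
    exists ('X + 2%:R * e%:P).
    by transitivity ('X ^+ 2 - 4%:R * e%:P ^+ 2 : {poly int});
      [ring | rewrite e2P mulr1].
  rewrite d2; have [-> ->] := chebyshevT_U k.
  transitivity ((2%:R * U k.+1 - 'X * U k) * ('X * U k.+1 - 2%:R * U k) -
     ('X + 2%:R * e%:P) * (U k.+1 ^+ 2 - 'X * U k * U k.+1 + U k ^+ 2)).
    by rewrite chebyshevU_cassini mulr1; ring.
  by ring: e2P.
have [he1 | he1] : e = 1 \/ e = -1.
  by move/eqP: he; rewrite sqrf_eq1 => /orP[] /eqP; [left|right].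
- exists ('X ^+ 2 - 4%:R), (U k); split=> //; last by exists 1; rewrite mulr1.
  by rewrite d1 he1 -chebyshevT_pell; ring.
- exists 1, (T k); split=> //; last by exists ('X ^+ 2 - 4%:R); rewrite mul1r.
  by rewrite d1 he1 polyCN; ring.
Qed.

(** * Polynomials over a field *)

(** Proves an equation from a known one when [ring] identifies the differences
    of their sides. *)
Lemma eq_of_subr_eq (V : zmodType) (l r a b : V) : l = r -> a - b = l - r -> a = b.
Proof. by move=> -> /eqP; rewrite subrr subr_eq0 => /eqP. Qed.

Lemma irredp_dvdM (F : fieldType) (phi a b : {poly F}) : irreducible_poly phi ->
  (phi %| a * b) = (phi %| a) || (phi %| b).
Proof.
move=> irr; apply/idP/orP => [|[h|h]]; [|exact: dvdp_mulr|exact: dvdp_mull].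
have [h|h] := boolP (phi %| a); first by left.
by rewrite Gauss_dvdpr ?irreducible_poly_coprime // => ->; right.
Qed.

Lemma irredp_dvdX (F : fieldType) (phi a : {poly F}) n : irreducible_poly phi ->
  phi %| a ^+ n -> phi %| a.
Proof.
move=> irr; elim: n => [|n IH].
  by rewrite expr0 dvdp1 => /eqP h; case: irr => [[]]; rewrite h.
by rewrite exprS irredp_dvdM // => /orP[|/IH].
Qed.

Lemma irredp_dvdC (F : fieldType) (phi : {poly F}) c : irreducible_poly phi ->
  phi %| c%:P -> c = 0.
Proof.
move=> irr h; apply/eqP/negPn/negP => c0.
have := dvdp_leq _ h; rewrite polyC_eq0 size_polyC c0 => /(_ isT).
by rewrite leqNgt; case: irr => ->.
Qed.

Lemma dvdp_sqr_deriv (F : fieldType) (phi f : {poly F}) :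
  phi ^+ 2 %| f -> phi %| f^`().
Proof.
move=> /dvdpP[s ->]; rewrite expr2 !derivM.
have -> : s^`() * (phi * phi) + s * (phi^`() * phi + phi * phi^`()) =
  phi * (s^`() * phi + s * phi^`() + s * phi^`()) by ring.
exact: dvdp_mulr.
Qed.

Lemma monic_irreducible_or_factor (F : finFieldType) (g : {poly F}) :
  g \is monic -> (1 < size g)%N ->
  irreducible_poly g \/ exists g1 g2 : {poly F},
   [/\ g1 \is monic, g2 \is monic, g = g1 * g2,
       (size g1 < size g)%N & (size g2 < size g)%N].
Proof.
move=> mg sg; case: (irreducibleP g) => [|/irreducibleP]; first by left.
rewrite /irreducibleb sg /= => /forallPn[q hq]; right; move: hq => /=.
rewrite negb_imply -Pdiv.Idomain.dvdpE -ltnNge => /andP[/dvdpP[r gE] sq].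
have gn0 := monic_neq0 mg.
have [r0 q0] : r != 0 /\ (q : {poly F}) != 0.
  by apply/andP; rewrite -negb_or -mulf_eq0 -gE.
have lc : lead_coef r * lead_coef q = 1 by rewrite -lead_coefM -gE; apply/monicP.
have lr : lead_coef r != 0 by rewrite lead_coef_eq0.
have lq : lead_coef q != 0 by rewrite lead_coef_eq0.
have sq2 : (size (q : {poly F}) < size g)%N.
  by rewrite (leq_ltn_trans (size_npoly q)) // prednK // ltnW.
have sr2 : (size r < size g)%N.
  rewrite gE size_mul // -subn1 -addnBA ?(ltnW sq) // -[X in (X < _)%N]addn0.
  by rewrite ltn_add2l subn_gt0.
exists ((lead_coef r)^-1 *: r), ((lead_coef q)^-1 *: (q : {poly F})).
rewrite !monicE !lead_coefZ !mulVf // !eqxx !size_scale ?invr_neq0 //; split=> //.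
by rewrite -scalerAl -scalerAr scalerA -invfM lc invr1 scale1r.
Qed.

(** * Reduction modulo a prime and the square of a maximal ideal *)

Lemma dvdz_Fp p (z : int) : prime p -> (p %| z)%Z = (z%:~R == 0 :> 'F_p).
Proof. by move=> pr_p; rewrite (dvdz_pcharf (pchar_Fp pr_p)). Qed.

Lemma red_p p : prime p -> red p p%:R = 0.
Proof. by move=> pr_p; rewrite rmorph_nat -polyC_natr pchar_Fp_0. Qed.

Lemma red_eq0 p f : prime p -> red p f = 0 -> exists g, f = p%:R * g.
Proof.
move=> pr_p f0; exists (map_poly (fun c => (c %/ p)%Z) f).
apply/polyP=> i; rewrite mulr_natl coefMn coef_map_id0 ?div0z //.
have : (p %| f`_i)%Z by rewrite dvdz_Fp // -coef_map f0 coef0.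
by rewrite -mulr_natr -natz => /divzK {1}<-.
Qed.

Lemma red_lift p (g : {poly 'F_p}) :
  exists f : {poly int}, [/\ red p f = g, size f = size g &
    g \is monic -> f \is monic].
Proof.
pose f : {poly int} := \poly_(i < size g) (nat_of_ord (g`_i)%R)%:Z.
have fE : red p f = g.
  apply/polyP=> i; rewrite coef_map coef_poly.
  case: ltnP => [_|h]; last by rewrite nth_default.
  exact: natr_Zp.
have sf : size f = size g.
  apply/eqP; rewrite eqn_leq size_poly -{1}fE.
  exact: size_poly.
exists f; split=> // /monicP g1.
rewrite monicE lead_coefE sf coef_poly.
have -> : ((size g).-1 < size g)%N.
  by rewrite prednK // lt0n size_poly_eq0 -lead_coef_eq0 g1 oner_eq0.
by rewrite -lead_coefE g1.
Qed.

Lemma size_red_monic p (f : {poly int}) : f \is monic -> size (red p f) = size f.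
Proof.
by move=> mf; rewrite size_map_poly_id0 // (monicP mf) oner_eq0.
Qed.

Lemma monic_red p (f : {poly int}) : f \is monic -> red p f \is monic.
Proof. by move=> mf; apply: monic_map. Qed.

Lemma natp_neq0 p : prime p -> p%:R != 0 :> {poly int}.
Proof.
by move=> pr_p; rewrite -polyC_natr polyC_eq0 pnatr_eq0 -lt0n prime_gt0.
Qed.

(** Divisibility after reduction is how membership in the ideal [(p, phi)] of
    [Z[X]] is expressed throughout. *)
Lemma dvdp_redP p phi f : prime p ->
  reflect (exists s t, f = phi * s + p%:R * t) (red p phi %| red p f).
Proof.
move=> pr_p; apply: (iffP idP) => [/dvdpP[s0 e]|[s [t ->]]]; last first.
  by rewrite rmorphD !rmorphM /= red_p // mul0r addr0 dvdp_mulr.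
have [s [es _ _]] := red_lift s0.
have /red_eq0[//|t et] : red p (f - phi * s) = 0.
  by rewrite rmorphB rmorphM /= es e mulrC subrr.
by exists s, t; rewrite -et addrC subrK.
Qed.

(** The square of the ideal [(p, phi)] of [Z[X]]. *)
Definition in_sqr_ideal (p : nat) (phi f : {poly int}) :=
  exists A B C : {poly int}, f = p%:R ^+ 2 * A + p%:R * phi * B + phi ^+ 2 * C.

Lemma in_sqr_idealD p phi f g :
  in_sqr_ideal p phi f -> in_sqr_ideal p phi g -> in_sqr_ideal p phi (f + g).
Proof.
move=> [A [B [C ->]]] [A' [B' [C' ->]]].
by exists (A + A'), (B + B'), (C + C'); ring.
Qed.

Lemma in_sqr_idealMl p phi f g : in_sqr_ideal p phi f -> in_sqr_ideal p phi (g * f).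
Proof. by move=> [A [B [C ->]]]; exists (g * A), (g * B), (g * C); ring. Qed.

Lemma in_sqr_idealB p phi f g :
  in_sqr_ideal p phi f -> in_sqr_ideal p phi g -> in_sqr_ideal p phi (f - g).
Proof.
move=> hf hg; apply: in_sqr_idealD => //.
by rewrite -mulN1r; apply: in_sqr_idealMl.
Qed.

Lemma in_sqr_ideal_mul p phi f g : prime p ->
  red p phi %| red p f -> red p phi %| red p g -> in_sqr_ideal p phi (f * g).
Proof.
move=> pr_p /(dvdp_redP _ _ pr_p)[s [t ->]] /(dvdp_redP _ _ pr_p)[s' [t' ->]].
by exists (t * t'), (s * t' + t * s'), (s * s'); ring.
Qed.

Lemma in_sqr_ideal_red p phi c : prime p ->
  in_sqr_ideal p phi c -> red p phi ^+ 2 %| red p c.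
Proof.
move=> pr_p [A [B [C ->]]].
rewrite !rmorphD !rmorphM /= red_p // !mul0r !add0r.
by rewrite dvdp_mulr // expr2.
Qed.

(** Since [p] and [phi] form a regular sequence, the classes of [p] and [phi]
    are a basis of [m / m^2] over [Z[X] / m], for [m = (p, phi)]. *)
Lemma in_sqr_ideal_p p phi c : prime p -> phi \is monic ->
  in_sqr_ideal p phi (p%:R * c) -> red p phi %| red p c.
Proof.
move=> pr_p mphi [A [B [C e]]].
have : red p (phi ^+ 2 * C) = 0.
  move/(congr1 (red p)): e.
  by rewrite !rmorphD !rmorphM /= red_p // !mul0r !add0r => <-.
rewrite rmorphM rmorphXn /= => /eqP; rewrite mulf_eq0 expf_eq0 /=.
rewrite (negPf (monic_neq0 (monic_red _ mphi))) /= => /eqP/red_eq0[//|D eC].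
have -> : c = p%:R * A + phi * B + phi ^+ 2 * D.
  apply: (mulfI (natp_neq0 pr_p)).
  by rewrite e eC; ring.
apply/(dvdp_redP _ _ pr_p); exists (B + phi * D), A; ring.
Qed.

(** * Evaluation of integer polynomials at an algebraic number *)

Definition zeval (theta : algC) (c : {poly int}) := (map_poly intr c).[theta].

Lemma zevalD t a b : zeval t (a + b) = zeval t a + zeval t b.
Proof. by rewrite /zeval rmorphD hornerD. Qed.

Lemma zevalN t a : zeval t (- a) = - zeval t a.
Proof. by rewrite /zeval rmorphN hornerN. Qed.

Lemma zevalM t a b : zeval t (a * b) = zeval t a * zeval t b.
Proof. by rewrite /zeval rmorphM hornerM. Qed.

Lemma zevalC t c : zeval t c%:P = c%:~R.
Proof. by rewrite /zeval map_polyC hornerC. Qed.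

Lemma zevalX t : zeval t 'X = t.
Proof. by rewrite /zeval map_polyX hornerX. Qed.

Lemma zeval_nat t n : zeval t n%:R = n%:R.
Proof. by rewrite /zeval rmorph_nat -polyC_natr hornerC. Qed.

Lemma zeval1 t : zeval t 1 = 1.
Proof. exact: (zeval_nat t 1). Qed.

Lemma zeval0 t : zeval t 0 = 0.
Proof. exact: (zeval_nat t 0). Qed.

Lemma zevalXn t a n : zeval t (a ^+ n) = zeval t a ^+ n.
Proof. by rewrite /zeval rmorphXn horner_exp. Qed.

Lemma zeval_sum t n (F : 'I_n -> {poly int}) :
  zeval t (\sum_i F i) = \sum_i zeval t (F i).
Proof.
elim/big_rec2: _ => [|i x y _ <-]; first exact: zeval0.
by rewrite zevalD.
Qed.

Definition zevalE := (zevalD, zevalN, zevalM, zevalC, zevalX, zeval_nat, zeval1,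
  zeval0, zevalXn).

Lemma AintP (x : algC) :
  reflect (exists2 P : {poly int}, P \is monic & zeval x P = 0) (x \in Aint).
Proof.
apply: (iffP idP) => [/floorpP[P eP]|[P mP P0]].
  have rx : root (map_poly intr P) x by rewrite -eP root_minCpoly.
  exists P; last exact/rootP.
  have := minCpoly_monic x; rewrite eP !monicE lead_coef_map_inj //.
    by rewrite -[1]/(1%:~R) eqr_int.
  exact: intr_inj.
apply: (@root_monic_Aint (map_poly intr P)).
- exact/rootP.
- exact: monic_map.
by apply/polyOverP=> i; rewrite coef_map intr_int.
Qed.

Lemma Aint_zeval theta c : theta \in Aint -> zeval theta c \in Aint.
Proof.
move=> tA; rewrite /zeval horner_coef rpred_sum // => i _.
by rewrite coef_map rpredM ?Aint_int ?rpredX.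
Qed.

Lemma Aint_root_quadratic (y b c : algC) : b \in Aint -> c \in Aint ->
  y ^+ 2 = b * y + c -> y \in Aint.
Proof.
move=> bA cA e; pose P : {poly algC} := 'X ^+ 2 - (b *: 'X + c%:P).
have sl : (size (b *: 'X + c%:P)%R < size ('X ^+ 2 : {poly algC})%R)%N.
  rewrite size_polyXn ltnS (leq_trans (size_polyD _ _)) // geq_max.
  rewrite (leq_trans (size_scale_leq _ _)) ?size_polyX //.
  by rewrite (leq_trans (size_polyC_leq1 _)).
have mP : P \is monic by rewrite monicE lead_coefDl ?size_polyN // lead_coefXn.
have rP : root P y by rewrite /root !hornerE e subrr.
suff /(integral_root_monic mP rP)[q mq rq] :
    {in P : seq algC, integralRange (intr : {rmorphism int -> algC})}.
  by apply/AintP; exists q => //; apply/rootP.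
move=> z /(nthP 0)[i _ <-].
suff /AintP[q mq rq] : P`_i \in Aint by exists q => //; apply/rootP.
rewrite coefB coefXn coefD coefZ coefX coefC rpredB ?rpredD ?rpredM //.
- by case: (_ == _); rewrite ?Aint1 ?Aint0.
- by case: (_ == _); rewrite ?Aint1 ?Aint0.
- by case: (_ == _); rewrite ?cA ?Aint0.
Qed.

Lemma map_ratr_intr (c : {poly int}) :
  map_poly ratr (map_poly intr c : {poly rat}) = map_poly intr c :> {poly algC}.
Proof. by rewrite -map_poly_comp; apply: eq_map_poly => z /=; rewrite ratr_int. Qed.

Lemma root_irreducible_dvdp (r s : {poly rat}) (x : algC) : irreducible_poly r ->
  root (map_poly ratr r) x -> root (map_poly ratr s) x -> r %| s.
Proof.
move=> irr rx sx; have [//|nd] := boolP (r %| s).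
move: nd; rewrite -irreducible_poly_coprime // => /Bezout_eq1_coprimepP[[u v] /= e].
move/(congr1 (fun q => (map_poly ratr q).[x])): e; rewrite rmorphD !rmorphM rmorph1.
rewrite !hornerE (rootP rx) (rootP sx) !mulr0 addr0 => /eqP.
by rewrite eq_sym oner_eq0.
Qed.

Lemma zeval_ker (f : {poly int}) theta : f \is monic ->
  irreducible_poly (map_poly intr f : {poly rat}) -> zeval theta f = 0 ->
  forall c, zeval theta c = 0 -> exists w, c = f * w.
Proof.
move=> mf irr f0 c c0.
have : map_poly intr f %| (map_poly intr c : {poly rat}).
  by apply: (@root_irreducible_dvdp _ _ theta irr); rewrite map_ratr_intr; apply/rootP.
rewrite dvdp_rat_int => /(Pdiv.IdomainMonic.dvdpP mf)[w ->].
by exists w; rewrite mulrC.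
Qed.

Lemma zeval_root_exists (f : {poly int}) : f \is monic -> (1 < size f)%N ->
  exists theta, zeval theta f = 0.
Proof.
move=> mf sf.
have /closed_rootP[theta ft] : size (map_poly intr f : {poly algC}) != 1%N.
  by rewrite size_map_inj_poly ?gtn_eqF //; exact: intr_inj.
by exists theta; apply/rootP.
Qed.

(** The denominator polynomial is inverted modulo [f] by Bezout, and the
    rational coefficients of the result have a common denominator. *)
Lemma in_Q_adjoin_denominator (f : {poly int}) theta x :
  irreducible_poly (map_poly intr f : {poly rat}) -> zeval theta f = 0 ->
  in_Q_adjoin theta x ->
  exists m c, (0 < m)%N /\ m%:R * x = zeval theta c.
Proof.
move=> irr f0 [P [Q ->]].
have [Q0|Qn0] := eqVneq ((map_poly ratr Q).[theta]) 0.
  by exists 1%N, 0; rewrite Q0 invr0 !mulr0 zeval0.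
have : coprimep (map_poly intr f) Q.
  rewrite irreducible_poly_coprime //; apply: contra_neqN Qn0 => /dvdpP[S ->].
  by rewrite rmorphM /= hornerM map_ratr_intr [X in _ * X]f0 mulr0.
move=> /Bezout_eq1_coprimepP[[u v] /=].
move/(congr1 (fun q => (map_poly ratr q).[theta])); rewrite rmorphD !rmorphM rmorph1 /=.
rewrite !hornerE map_ratr_intr [X in _ * X + _]f0 mulr0 add0r => e.
have -> : (map_poly ratr P).[theta] / (map_poly ratr Q).[theta] =
    (map_poly ratr (P * v)).[theta].
  rewrite rmorphM hornerM; apply: (canLR (mulfK Qn0)).
  by rewrite -mulrA e mulr1.
have [q [a an0 ->]] := rat_poly_scale (P * v).
have e2 : a%:~R * (map_poly ratr (a%:~R^-1 *: map_poly intr q)).[theta] = zeval theta q.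
  rewrite map_polyZ hornerZ map_ratr_intr fmorphV /= ratr_int mulrA divff ?mul1r //.
  by rewrite intr_eq0.
exists `|a|%N, ((sgz a)%:P * q); rewrite absz_gt0; split=> //.
rewrite zevalM zevalC -e2 mulrA -intrM; congr (_ * _).
by rewrite -abszEsg.
Qed.

(** * Dedekind's criterion *)

(** Homogenizing a monic equation of [y] by [c] turns [c y = b], for [c] in [(p,
    phi)], into the congruence [b ^ n = 0] modulo [(p, phi)]. In other words, if
    [m = (p, phi)] and [m y] lies in [Z[theta]], then [m y] lies in [m
    Z[theta]]. *)
Lemma conductor_stable p f theta y phi b c : prime p ->
  (forall c, zeval theta c = 0 -> exists w, c = f * w) -> y \in Aint ->
  irreducible_poly (red p phi) -> red p phi %| red p f ->
  red p phi %| red p c -> zeval theta c * y = zeval theta b ->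
  red p phi %| red p b.
Proof.
move=> pr_p ker /AintP[P mP P0] irr hf hc e.
have [n sP] : exists n, size P = n.+1.
  by exists (size P).-1; rewrite prednK // size_poly_gt0 monic_neq0.
pose W := \sum_(i < n.+1) (P`_i)%:P * b ^+ i * c ^+ (n - i).
have W0 : zeval theta W = 0.
  have Py : \sum_(i < n.+1) (P`_i)%:~R * y ^+ i = 0.
    rewrite -[RHS]P0 /zeval horner_coef.
    rewrite size_map_poly_id0 ?intr_eq0 ?lead_coef_eq0 ?monic_neq0 // sP.
    by apply: eq_bigr => i _; rewrite coef_map.
  rewrite zeval_sum -[RHS](mulr0 (zeval theta c ^+ n)) -[in RHS]Py mulr_sumr.
  apply: eq_bigr => i _; rewrite !zevalE -e exprMn.
  have -> : zeval theta c ^+ n = zeval theta c ^+ i * zeval theta c ^+ (n - i).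
    by rewrite -exprD subnKC // -ltnS.
  by ring.
have [w eW] := ker _ W0.
have : red p phi %| red p W by rewrite eW rmorphM dvdp_mulr.
rewrite /W big_ord_recr /= subnn expr0 mulr1.
have -> : P`_n = 1 by rewrite -(monicP mP) lead_coefE sP.
rewrite mul1r rmorphD /= dvdp_addr => [|]; last first.
  rewrite rmorph_sum /=; elim/big_ind: _ => [||i _]; first exact: dvdp0.
    by move=> u v; apply: dvdp_add.
  have -> : (n - i = (n - i).-1.+1)%N by rewrite prednK // subn_gt0.
  by rewrite exprS mulrCA rmorphM dvdp_mulr.
by rewrite rmorphXn; apply: irredp_dvdX.
Qed.

(** The polynomial [phi] generates, together with [p], an ideal multiplying [y]
    into [Z[theta]]. If [phi] factors modulo [p], its factors are handled one
    after the other, which is an induction on the degree. If [phi] is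
    irreducible, set [m = (p, phi)]; then [p y = g] and [phi y = h] with [g],
    [h] in [m], so [p h - phi g] is a multiple [f w] of [f] lying in [m^2]. As
    [f] is not in [m^2], [w] is in [m], and then [f w] can be absorbed into [g]
    and [h], leaving an equation [p h' = phi g'], which forces [p] to divide
    [g']. *)
Lemma dedekind_p_maximal p f theta : prime p -> f \is monic -> zeval theta f = 0 ->
  (forall c, zeval theta c = 0 -> exists w, c = f * w) ->
  (forall phi, phi \is monic -> irreducible_poly (red p phi) ->
     ~ in_sqr_ideal p phi f) ->
  forall y g, y \in Aint -> p%:R * y = zeval theta g ->
  exists s, y = zeval theta s.
Proof.
move=> pr_p mf f0 ker Hsq.
have tA : theta \in Aint by apply/AintP; exists f.
have np0 : p%:R != 0 :> algC by rewrite pnatr_eq0 -lt0n prime_gt0.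
have bezout (phi c : {poly int}) : irreducible_poly (red p phi) ->
    ~~ (red p phi %| red p c) -> exists u v t, u * phi + v * c = 1 + p%:R * t.
  move=> irr; rewrite -irreducible_poly_coprime // => /Bezout_eq1_coprimepP.
  move=> [[u0 v0] /= e]; have [u [eu _ _]] := red_lift u0.
  have [v [ev _ _]] := red_lift v0.
  have [|t et] := @red_eq0 p (u * phi + v * c - 1) pr_p.
    by rewrite rmorphB rmorphD !rmorphM rmorph1 /= eu ev e subrr.
  by exists u, v, t; rewrite -et [RHS]addrC subrK.
suff main k (phi : {poly int}) y (g h : {poly int}) :
    (size phi <= k)%N -> phi \is monic -> y \in Aint ->
    p%:R * y = zeval theta g -> zeval theta phi * y = zeval theta h ->
    exists s, y = zeval theta s.
  move=> y g yA eg; apply: (main _ f y g 0 (leqnn _)) => //.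
  by rewrite f0 mul0r zeval0.
elim: k phi y g h => [|k IH] phi y g h sphi mphi yA eg eh.
  by move: sphi; rewrite leqNgt size_poly_gt0 monic_neq0.
have [s1|s1] := leqP (size phi) 1.
  have e1 : phi = 1.
    by move: mphi; rewrite (size1_polyC s1) monicE lead_coefC => /eqP ->.
  by exists h; rewrite -eh e1 zeval1 mul1r.
case: (@monic_irreducible_or_factor _ (red p phi)).
- exact: monic_red.
- by rewrite size_red_monic.
- move=> irr.
  have [hf|nf] := boolP (red p phi %| red p f); last first.
    have [u [v [t e]]] := bezout _ _ irr nf.
    exists (u * h - t * g); rewrite !zevalE -eg -eh.
    move/(congr1 (fun q => zeval theta q * y)): e; rewrite !zevalE f0 => e.
    by apply: (eq_of_subr_eq (esym e)); ring.
  have hg : red p phi %| red p g.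
    apply: (@conductor_stable p f theta y phi g p%:R) => //.
      by rewrite red_p ?dvdp0.
    by rewrite zeval_nat.
  have hh : red p phi %| red p h.
    by apply: (@conductor_stable p f theta y phi h phi).
  case/(dvdp_redP _ _ pr_p): hg => g2 [g1 eg12].
  case/(dvdp_redP _ _ pr_p): hh => h2 [h1 eh12].
  have [|w ew] := ker (p%:R * h - phi * g).
    by rewrite !zevalE -eg -eh; ring.
  have fw : in_sqr_ideal p phi (f * w).
    by exists h1, (h2 - g1), (- g2); rewrite -ew eg12 eh12; ring.
  have [hw|nw] := boolP (red p phi %| red p w); last first.
    have [u [v [t e]]] := bezout _ _ irr nw.
    case: (Hsq phi mphi irr).
    have -> : f = v * (f * w) + f * (u * phi - p%:R * t).
      transitivity (f * ((u * phi + v * w) - p%:R * t)); last by ring.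
      by rewrite e; ring.
    apply: in_sqr_idealD; first exact: in_sqr_idealMl.
    apply: in_sqr_ideal_mul => //.
    rewrite rmorphB !rmorphM /= red_p // mul0r subr0.
    exact: dvdp_mull.
  case/(dvdp_redP _ _ pr_p): hw => w2 [w1 ew12].
  (* Adding multiples of [f] to [g] and [h] does not change [p y] and [phi y]. *)
  have e3 : p%:R * (h - f * w1) = phi * (g + f * w2).
    by rewrite ew12 in ew; apply: (eq_of_subr_eq ew); ring.
  have [|s es] := @red_eq0 p (g + f * w2) pr_p.
    move/(congr1 (red p)): e3; rewrite !rmorphM /= red_p // mul0r => /esym/eqP.
    by rewrite mulf_eq0 (negPf (monic_neq0 (monic_red _ mphi))) => /eqP.
  exists s; apply: (mulfI np0).
  by rewrite eg -(zeval_nat theta p) -zevalM -es !zevalE f0; ring.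
(* Here [f2 (f1 y)] lies in [Z[theta]], as [phi = f1 f2] modulo [p]: use the
   induction hypothesis for [f1 y] and [f2], then for [y] and [f1]. *)
- move=> [g1 [g2 [m1 m2 eg12 l1 l2]]].
  have [f1 [e1 s1' /(_ m1) mf1]] := red_lift g1.
  have [f2 [e2 s2' /(_ m2) mf2]] := red_lift g2.
  rewrite size_red_monic // in l1 l2.
  have [|t et] := @red_eq0 p (phi - f1 * f2) pr_p.
    by rewrite rmorphB rmorphM /= e1 e2 eg12 subrr.
  have [||||s es] := IH f2 (zeval theta f1 * y) (f1 * g) (h - t * g) _ mf2.
  - by rewrite -ltnS (leq_trans _ sphi) // s2'.
  - by rewrite rpredM // Aint_zeval.
  - by rewrite !zevalE -eg; ring.
  - move/(congr1 (fun q => zeval theta q * y)): et; rewrite !zevalE -eg -eh => et.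
    by apply: (eq_of_subr_eq (esym et)); ring.
  by apply: (IH f1 y g s) => //; rewrite -ltnS (leq_trans _ sphi) // s1'.
Qed.

(** A denominator of an integer of [Q(theta)] is removed one prime at a time. *)
Lemma monogenic_of_dedekind (f : {poly int}) : f \is monic ->
  irreducible_poly (map_poly intr f : {poly rat}) ->
  (forall p, prime p -> forall phi : {poly int}, phi \is monic ->
     irreducible_poly (red p phi) -> ~ in_sqr_ideal p phi f) -> monogenic f.
Proof.
move=> mf irr Hsq; split=> // theta /rootP f0 x.
have tA : theta \in Aint by apply/AintP; exists f.
split.
  move=> [c ->]; split; last exact: Aint_zeval.
  exists (map_poly intr c), 1.
  by rewrite map_ratr_intr rmorph1 hornerC divr1.
move=> [/(in_Q_adjoin_denominator irr f0)[m [c [m0 e]]] xA].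
elim/ltn_ind: m x xA c m0 e => m IH x xA c m0 e.
have [m1|m1] := leqP m 1.
  by exists c; rewrite -[RHS]e (_ : m = 1%N) ?mul1r //; apply/eqP; rewrite eqn_leq m1.
have pr_p := pdiv_prime m1; set p := pdiv m in pr_p.
have mE : m = (m %/ p * p)%N by rewrite divnK // pdiv_dvd.
have [||s es] := dedekind_p_maximal pr_p mf f0 (zeval_ker mf irr f0) (Hsq p pr_p)
  (y := (m %/ p)%N%:R * x) (g := c).
- by rewrite rpredM // -[_%:R]/((m %/ p)%N%:Z%:~R) Aint_int.
- by rewrite mulrA -natrM mulnC -mE.
apply: (IH (m %/ p)%N _ x xA s) => //.
  by rewrite ltn_Pdiv // prime_gt1.
by rewrite divn_gt0 ?prime_gt0 // dvdn_leq // pdiv_dvd.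
Qed.

(** * Frobenius congruences for Chebyshev polynomials *)

Lemma Fp_expX p k (x : 'F_p) : prime p -> x ^+ (p ^ k) = x.
Proof.
move=> pr_p; elim: k => [|k IH]; first by rewrite expn0 expr1.
by rewrite expnSr exprM IH -{2}(expf_card x) card_Fp.
Qed.

(** Modulo [p] the derivative [p U_p] vanishes, so only the coefficients of
    degree [0] and [p] survive, and the constant one is determined by the value
    at [2], because [2 ^ p = 2] modulo [p]. *)
Lemma red_chebyshevT_prime p : prime p -> red p (T p) = 'X^p.
Proof.
move=> pr_p; have p1 := prime_gt0 pr_p.
have [sT mT] : size (T p) = p.+1 /\ T p \is monic.
  by have := chebyshevT_size_monic p.-1; rewrite prednK.
have H : red p (T p) = 'X^p + ((T p)`_0)%:~R%:P.
  apply/polyP=> i; rewrite coef_map coefD coefXn coefC.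
  case: (ltngtP i p) => [lt|gt|->].
  - rewrite add0r; case: i lt => [//|i] lt.
    have := congr1 (fun q => (red p q)`_i) (chebyshevT_deriv p).
    rewrite coef_map coef_deriv rmorphM rmorph_nat -polyC_natr pchar_Fp_0 // mul0r.
    rewrite coef0 /= -mulr_natr natz intrM => /eqP; rewrite mulf_eq0.
    case/orP=> [/eqP //|]; rewrite -dvdz_Fp // => /dvdn_leq /= /(_ isT).
    by rewrite leqNgt lt.
  - by rewrite nth_default ?sT // (gtn_eqF (leq_ltn_trans _ gt)) //= addr0.
  - have -> : (T p)`_p = 1 by rewrite -(monicP mT) lead_coefE sT.
    by rewrite (gtn_eqF p1) addr0.
have := congr1 (fun q => (red p q).[2%:R]) (erefl (T p)).
rewrite {1}H -[2%:R]/(2%:~R) horner_map chebyshevT_2.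
have E2 : 2%:~R ^+ p = 2%:~R :> 'F_p.
  by have := Fp_expX 1 2%:~R pr_p; rewrite expn1.
rewrite hornerD hornerXn hornerC E2 -[RHS]addr0 => /addrI c0.
by rewrite H c0 addr0.
Qed.

Lemma red_chebyshevT p k : prime p -> red p (T (p ^ k)) = 'X^(p ^ k).
Proof.
move=> pr_p; elim: k => [|k IH]; first by rewrite map_polyX.
rewrite expnS -chebyshevT_comp map_comp_poly red_chebyshevT_prime // IH.
by rewrite comp_Xn_poly -exprM mulnC.
Qed.

Lemma chebyshevT_frobenius p k (a : int) : prime p -> exists V : {poly int},
  T (p ^ k) - a%:P = ('X - a%:P) ^+ (p ^ k) + p%:R * V.
Proof.
move=> pr_p.
have [|V eV] := @red_eq0 p (T (p ^ k) - a%:P - ('X - a%:P) ^+ (p ^ k)) pr_p.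
  rewrite !rmorphB rmorphXn rmorphB /= red_chebyshevT // map_polyX map_polyC /=.
  have pX : p \in [pchar {poly 'F_p}] by rewrite pchar_poly pchar_Fp.
  have cq : [pchar {poly 'F_p}].-nat (p ^ k)%N by rewrite pnatX pnatE // pX.
  by rewrite exprDn_pchar // exprNn_pchar // -polyC_exp Fp_expX // subrr.
by exists V; rewrite -eV [RHS]addrC subrK.
Qed.

(** For [M = 1] this is the expansion of [T_p - a] in powers of ['X - a], with
    the constant term [p v] split off; composing with [T_M] gives the general
    case. *)
Lemma chebyshevT_mul_prime_expansion p M (a : int) : prime p ->
  exists (v : int) (W : {poly int}),
  T (M * p) - a%:P =
    (T M - a%:P) * ((T M - a%:P) ^+ p.-1 + p%:R * W) + p%:R * v%:P
  /\ (T p).[a] - a = p%:Z * v.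
Proof.
move=> pr_p; have [V eV] := chebyshevT_frobenius 1 a pr_p; rewrite expn1 in eV.
have /factor_theorem[W e] : root (V - V.[a]%:P) a by rewrite /root !hornerE subrr.
have p1 : p = p.-1.+1 by rewrite prednK // prime_gt0.
exists V.[a], (W \Po T M); split.
  have -> : T (M * p) - a%:P = (T p - a%:P) \Po T M.
    by rewrite comp_polyB comp_polyC chebyshevT_comp mulnC.
  rewrite eV {1}p1 exprS -[V in LHS](subrK V.[a]%:P) e.
  rewrite !(comp_polyB, comp_polyD, comp_polyM) rmorphXn /= comp_polyB.
  by rewrite comp_polyX !comp_polyC -!polyC_natr !comp_polyC; ring.
move/(congr1 (fun q => q.[a])): eV.
rewrite !hornerE subrr expr0n eqn0Ngt prime_gt0 //= add0r => ->.
by rewrite -polyC_natr hornerC natz.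
Qed.

Lemma horner_sub_factor (V : {poly int}) a b : exists w, V.[b] - V.[a] = (b - a) * w.
Proof.
have /factor_theorem[W e] : root (V - V.[a]%:P) a by rewrite /root !hornerE subrr.
by exists W.[b]; move/(congr1 (fun q => q.[b])): e; rewrite !hornerE mulrC.
Qed.

Lemma eqz_modP (a b m : int) : (a = b %[mod m])%Z <-> exists c, a - b = m * c.
Proof.
split=> [/eqP|[c e]]; rewrite ?eqz_mod_dvd.
  by move=> /dvdzP[c e]; exists c; rewrite e mulrC.
by apply/eqP; rewrite eqz_mod_dvd e dvdz_mulr.
Qed.

(** If [b] and [a] are congruent modulo [p], then [T_p(b)] and [T_p(a)] are
    congruent modulo [p^2]; this is applied to [b = T_(p^k)(a)]. *)
Lemma chebyshevT_prime_power_mod p k (a : int) : prime p ->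
  ((T (p ^ k.+1)).[a] = (T p).[a] %[mod p%:Z ^+ 2])%Z.
Proof.
move=> pr_p; elim: k => [|k IH]; first by rewrite expn1.
have [V eV] := chebyshevT_frobenius 1 a pr_p; rewrite expn1 in eV.
have hV b : (T p).[b] - a = (b - a) ^+ p + p%:Z * V.[b].
  move/(congr1 (fun q => q.[b])): eV; by rewrite !hornerE -polyC_natr hornerC natz.
rewrite expnS -chebyshevT_comp horner_comp; set b := (T (p ^ k.+1)).[a].
have [c ec] : exists c, b - a = p%:Z * c.
  case/eqz_modP: IH => c; rewrite -/b => ec; exists (p%:Z * c + V.[a]).
  have := hV a; rewrite subrr expr0n eqn0Ngt prime_gt0 //= add0r => ha.
  by rewrite mulrDr -ha mulrA -expr2 -ec; ring.
have [w ew] := horner_sub_factor V a b.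
apply/eqz_modP; exists (p%:Z ^+ (p - 2) * c ^+ p + c * w).
rewrite (_ : _ - _ = ((T p).[b] - a) - ((T p).[a] - a)); last by ring.
rewrite !hV subrr [0 ^+ _]expr0n eqn0Ngt prime_gt0 //= add0r ec exprMn.
have -> : p%:Z ^+ p = p%:Z ^+ (p - 2) * p%:Z ^+ 2.
  by rewrite -exprD subnK // prime_gt1.
have ew' : V.[b] = V.[a] + p%:Z * c * w by rewrite -ec -ew; ring.
by rewrite ew'; ring.
Qed.

(** * Irreducibility *)

(** Substituting ['X + a] for ['X] gives a polynomial congruent to ['X^(p ^
    k.+1)] modulo [p], with constant term congruent to [T_p(a) - a] modulo
    [p^2]. *)
Lemma chebyshevT_eisenstein p k (a : int) : prime p ->
  ~ ((T p).[a] = a %[mod p%:Z ^+ 2])%Z ->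
  exists E : {poly int}, [/\ irreducible_poly (map_poly intr E : {poly rat}),
    size E = (p ^ k.+1).+1 & T (p ^ k.+1) - a%:P = E \Po ('X - a%:P)].
Proof.
move=> pr_p ha; have [V eV] := chebyshevT_frobenius k.+1 a pr_p.
set q := (p ^ k.+1)%N in eV *; have q0 : (0 < q)%N by rewrite expn_gt0 prime_gt0.
have [sTa mTa] := size_monic_chebyshevT_sub a q0.
pose E := (T q - a%:P) \Po ('X + a%:P).
have EE : E = 'X^q + p%:R * (V \Po ('X + a%:P)).
  rewrite /E eV comp_polyD comp_polyM rmorphXn /= comp_polyB comp_polyX.
  by rewrite comp_polyC addrK -polyC_natr comp_polyC.
have sE : size E = q.+1 by rewrite size_comp_poly2 // size_XaddC.
exists E; split=> //; last first.
  rewrite /E -comp_polyA [('X + _) \Po _]comp_polyD comp_polyX comp_polyC subrK.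
  by rewrite comp_polyXr.
apply/irreducible_rat_int; apply: (eisenstein_crit pr_p).
- by rewrite sE eqSS -lt0n.
- rewrite lead_coef_comp ?size_XaddC // (monicP mTa) lead_coefXaddC expr1n mulr1.
  by rewrite dvdzE dvdn1 gtn_eqF // prime_gt1.
- apply/negP => h; apply: ha.
  apply: eq_trans (esym (chebyshevT_prime_power_mod k a pr_p)) _.
  apply/eqP; rewrite eqz_mod_dvd -/q; move: h.
  by rewrite -horner_coef0 /E horner_comp !hornerE.
- move=> i; rewrite sE /= => lt; rewrite EE coefD coefXn (ltn_eqF lt) add0r.
  by rewrite mulr_natl coefMn -mulr_natr natz dvdz_mull.
Qed.

Lemma irreducible_dim (L : fieldExtType rat) (r : {poly rat}) (x : L) :
  irreducible_poly r -> root (map_poly (in_alg L) r) x ->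
  \dim <<1; x>>%VS = (size r).-1.
Proof.
move=> irr rx.
have /polyOver1P[q eq_] := minPolyOver 1 x.
have dv : q %| r.
  rewrite -(dvdp_map (in_alg L)) -eq_ minPoly_dvdp //.
  by apply/polyOver1P; exists r.
have sq : size q = (adjoin_degree 1 x).+1.
  by rewrite -(size_minPoly 1 x) eq_ size_map_poly.
have /eqp_size <- : q %= r.
  by apply: irr => //; rewrite sq; rewrite /adjoin_degree.
by rewrite sq /= adjoin_degreeE dimv1 divn1.
Qed.

(** For a root [x] of a factor of [F], the field [Q(x)] contains [Q(G(x))], of
    degree the [p]-part of [N]. By multiplicativity of degrees, the degree of
    [x] is divisible by every such part, hence by [N]. *)
Lemma irreducible_of_part_comp (F : {poly rat}) N : size F = N.+1 -> (0 < N)%N ->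
  (forall p, p \in \pi(N) -> exists r G : {poly rat},
     [/\ irreducible_poly r, size r = (N`_p).+1 & F = r \Po G]) ->
  irreducible_poly F.
Proof.
move=> sF N0 hr.
have Fn0 : F != 0 by rewrite -size_poly_gt0 sF.
split=> [|g sg gF]; first by rewrite sF ltnS.
have gn0 : g != 0 by apply: contraNneq Fn0 => g0; move: gF; rewrite g0 dvd0p.
have /closed_rootP[theta gt] : size (map_poly ratr g : {poly algC}) != 1%N.
  by rewrite size_map_poly.
have [L [LC [s1 es _]]] := num_field_exists [:: theta].
case: s1 es => [//|x [|//]] [ex].
have LCE (h : {poly rat}) : map_poly LC (map_poly (in_alg L) h) = map_poly ratr h.
  rewrite -map_poly_comp; apply: eq_map_poly => z.
  exact: (fmorph_eq_rat (LC \o in_alg L)).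
have gx : root (map_poly (in_alg L) g) x.
  by rewrite -(fmorph_root LC) LCE ex.
have polyO (h : {poly rat}) : map_poly (in_alg L) h \is a polyOver 1%VS.
  by apply/polyOver1P; exists h.
have le : (\dim <<1; x>>%VS <= (size g).-1)%N.
  have := minPoly_dvdp (polyO g) gx => /dvdp_leq.
  rewrite map_poly_eq0 => /(_ gn0); rewrite size_minPoly size_map_poly.
  rewrite adjoin_degreeE dimv1 divn1 => h.
  by rewrite -ltnS prednK ?size_poly_gt0.
have dv : (N %| \dim <<1; x>>%VS)%N.
  apply/dvdn_partP => // p /hr[r [G [irr sr FE]]].
  pose b := (map_poly (in_alg L) G).[x].
  have rb : root (map_poly (in_alg L) r) b.
    rewrite /b /root -horner_comp -map_comp_poly -FE.
    by have /dvdpP[s ->] := gF; rewrite rmorphM /= hornerM (rootP gx) mulr0.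
  have <- : \dim <<1; b>>%VS = (N`_p)%N by rewrite (irreducible_dim irr rb) sr.
  apply: field_dimS; apply/FadjoinP; split; first exact: subv_adjoin.
  exact: mempx_Fadjoin.
rewrite -dvdp_size_eqp // eqn_leq dvdp_leq // sF /=.
rewrite -[size g]prednK ?size_poly_gt0 // ltnS (leq_trans _ le) //.
by rewrite dvdn_leq // adim_gt0.
Qed.

Lemma chebyshevT_irreducible N (a : int) : (0 < N)%N ->
  (forall p : nat, prime p -> (p %| N)%N ->
     ~ ((T p).[a] = a %[mod p%:Z ^+ 2])%Z) ->
  irreducible_poly (map_poly intr (T N - a%:P) : {poly rat}).
Proof.
move=> N0 ha; apply: (@irreducible_of_part_comp _ N) => //.
  rewrite size_map_inj_poly //; last exact: intr_inj.
  by have [] := size_monic_chebyshevT_sub a N0.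
move=> p; rewrite mem_primes => /and3P[pr_p _ pN].
have lN : (0 < logn p N)%N by rewrite logn_gt0 mem_primes pr_p N0.
have [E [irr sE eE]] := chebyshevT_eisenstein (logn p N).-1 pr_p (ha p pr_p pN).
rewrite prednK // -p_part in sE eE.
exists (map_poly intr E), (map_poly intr (('X - a%:P) \Po T (N %/ N`_p)%N)).
split=> //; first by rewrite size_map_inj_poly //; exact: intr_inj.
rewrite -map_comp_poly comp_polyA -eE comp_polyB comp_polyC chebyshevT_comp.
by rewrite mulnC divnK // dvdn_part.
Qed.

(** * The criterion for Chebyshev polynomials *)

(** Here [T_N - a = G ^ p + p (G W + v)] with [G = T_(N/p) - a] and [p v =
    T_p(a) - a]. If this lies in [m^2] for [m = (p, phi)], then [G] lies in [m],
    so [G ^ p] lies in [m^2], and finally [v] would lie in [m]. *)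
Lemma chebyshevT_dedekind_dvd p N (a : int) (phi : {poly int}) :
  prime p -> (p %| N)%N ->
  ~ ((T p).[a] = a %[mod p%:Z ^+ 2])%Z -> phi \is monic ->
  irreducible_poly (red p phi) -> ~ in_sqr_ideal p phi (T N - a%:P).
Proof.
move=> pr_p /dvdnP[M ->] ha mphi irr hsq.
have [v [W [eT ev]]] := chebyshevT_mul_prime_expansion M a pr_p.
pose G := T M - a%:P.
have eN : T (M * p) - a%:P = G ^+ p + p%:R * (G * W + v%:P).
  have -> : G ^+ p = G * G ^+ p.-1 by rewrite -exprS prednK // prime_gt0.
  by rewrite eT -/G; ring.
have hG : red p phi %| red p G.
  have := in_sqr_ideal_red pr_p hsq; rewrite eN rmorphD rmorphXn rmorphM /= red_p //.
  rewrite mul0r addr0 => h; apply: (irredp_dvdX irr (n := p)).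
  by apply: dvdp_trans h; rewrite expr2 dvdp_mulr.
have hGp : in_sqr_ideal p phi (G ^+ p).
  have -> : G ^+ p = G ^+ (p - 2) * (G * G).
    by rewrite -expr2 -exprD subnK // prime_gt1.
  by apply: in_sqr_idealMl; apply: in_sqr_ideal_mul.
have := in_sqr_idealB hsq hGp; rewrite eN addrC addKr => /(in_sqr_ideal_p pr_p mphi).
rewrite rmorphD rmorphM /= dvdp_addr ?dvdp_mulr // map_polyC => /(irredp_dvdC irr).
move/eqP; rewrite -dvdz_Fp // => /dvdzP[c ec]; apply: ha.
by apply/eqz_modP; exists c; rewrite ev ec; ring.
Qed.

(** A multiple root of [T_N - a] modulo [p] is a root of [U_N], so by the Pell
    equation [a ^ 2 - 4 = 0] modulo [p]. Then [T_N - a = R Q^2 - p c] with [c] a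
    unit modulo [p], where [R] has no multiple factor modulo [p]. So if [phi ^
    2] divides [R Q^2] modulo [p], then [phi] divides [Q], and [p c] would lie
    in [m^2]. *)
Lemma chebyshevT_dedekind_ndvd p N (a : int) (phi : {poly int}) : prime p ->
  ~~ (p %| N)%N -> ~ (a = 2 %[mod p%:Z ^+ 2])%Z -> ~ (a = - 2 %[mod p%:Z ^+ 2])%Z ->
  phi \is monic -> irreducible_poly (red p phi) -> ~ in_sqr_ideal p phi (T N - a%:P).
Proof.
move=> pr_p pN h1 h2 mphi irr hsq.
have h := in_sqr_ideal_red pr_p hsq.
have [e [he /dvdzP[c ec]]] : exists e : int, e ^+ 2 = 1 /\ (p %| a - 2 * e)%Z.
  have hf : red p phi %| red p (T N - a%:P).
    by apply: dvdp_trans h; rewrite expr2 dvdp_mulr.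
  have hU : red p phi %| red p (U N).
    have := dvdp_sqr_deriv h; rewrite deriv_map derivB derivC subr0.
    rewrite chebyshevT_deriv rmorphM rmorph_nat /= irredp_dvdM //.
    case/orP=> //; rewrite -polyC_natr => /(irredp_dvdC irr)/eqP.
    by rewrite -[_%:R]/(N%:Z%:~R) -dvdz_Fp // dvdzE /= (negPf pN).
  have : red p phi %| red p (a ^+ 2 - 4)%:P.
    have -> : (a ^+ 2 - 4)%:P = ('X ^+ 2 - 4%:R) * U N ^+ 2
        - (T N - a%:P) * (T N + a%:P) :> {poly int}.
      rewrite -chebyshevT_pell polyCB polyCMn rmorphXn /=; ring.
    rewrite rmorphB; apply: dvdp_sub; rewrite rmorphM; last exact: dvdp_mulr.
    by apply: dvdp_mull; rewrite rmorphXn expr2; apply: dvdp_mulr.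
  rewrite map_polyC => /(irredp_dvdC irr)/eqP /=.
  have -> : a ^+ 2 - 4 = (a - 2 * 1) * (a - 2 * -1) by ring.
  rewrite intrM mulf_eq0 -!dvdz_Fp // => /orP[] hh; first by exists 1.
  by exists (-1).
have pc : ~~ (p %| c)%Z.
  apply/negP => /dvdzP[c' ec'].
  have : (a = 2 * e %[mod p%:Z ^+ 2])%Z.
    by apply/eqz_modP; exists c'; rewrite ec ec'; ring.
  by move/eqP: he; rewrite sqrf_eq1 => /orP[] /eqP ->.
have [R [Q [eRQ [S eS] oddR]]] := chebyshevT_square_part N he.
have ef : T N - a%:P = R * Q ^+ 2 - p%:R * c%:P.
  have -> : p%:R * c%:P = (a - 2 * e)%:P :> {poly int}.
    by rewrite ec polyCM mulrC -polyC_natr natz.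
  by rewrite -eRQ polyCB; ring.
have [hQ|nQ] := boolP (red p phi %| red p Q).
  have hRQ : in_sqr_ideal p phi (R * Q ^+ 2).
    by apply: in_sqr_idealMl; rewrite expr2; apply: in_sqr_ideal_mul.
  have := in_sqr_idealB hRQ hsq; rewrite ef opprB addrC subrK.
  move=> /(in_sqr_ideal_p pr_p mphi).
  by rewrite map_polyC => /(irredp_dvdC irr)/eqP; rewrite -dvdz_Fp // (negPf pc).
have hR : red p phi ^+ 2 %| red p R.
  move: h; rewrite ef rmorphB !rmorphM /= red_p // mul0r subr0 mulrA -mulrA -expr2.
  rewrite Gauss_dvdpl // coprimep_expl // coprimep_expr //.
  by rewrite irreducible_poly_coprime.
(* For odd [p], ['X^2 - 4] is squarefree modulo [p]; for [p = 2] it is not, but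
   then [N] is odd and [R] is linear. *)
have [p2|np2] := eqVneq p 2%N.
  have oN : odd N by move: pN; rewrite p2 dvdn2 negbK.
  have := dvdp_sqr_deriv hR; rewrite deriv_map (oddR oN) derivB derivX derivC subr0.
  rewrite rmorph1 -polyC1 => /(irredp_dvdC irr)/eqP; by rewrite oner_eq0.
have hX : red p phi ^+ 2 %| red p ('X ^+ 2 - 4%:P).
  by rewrite -eS rmorphM dvdp_mulr.
have := dvdp_sqr_deriv hX; rewrite deriv_map => hX'.
have : red p phi %| red p 8%:P.
  have -> : 8%:P = 'X * ('X ^+ 2 - 4%:P)^`() - 2%:R * ('X ^+ 2 - 4%:P) :> {poly int}.
    by rewrite derivB derivC derivXn !polyCMn; ring.
  rewrite rmorphB; apply: dvdp_sub; rewrite rmorphM; apply: dvdp_mull => //.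
  by apply: dvdp_trans hX; rewrite expr2 dvdp_mulr.
rewrite map_polyC => /(irredp_dvdC irr)/eqP; rewrite -dvdz_Fp // dvdzE.
rewrite (_ : `|8| = 2 ^ 3)%N // Euclid_dvdX // andbT dvdn_prime2 //.
by rewrite (negPf np2).
Qed.

(** * Algebraic integers outside the order *)

(** The powers of [theta] below the degree of [f] form a basis of [Z[theta]], so
    [g(theta) / p] is not in [Z[theta]] unless [p] divides [g]. *)
Lemma monogenic_no_integral_quotient (f g : {poly int}) p theta y :
  monogenic f -> zeval theta f = 0 -> prime p -> (size g < size f)%N ->
  red p g != 0 -> p%:R * y = zeval theta g -> y \notin Aint.
Proof.
move=> [mf irr mono] f0 pr_p sg g0 ey; apply/negP => yA.
have np0 : p%:R != 0 :> algC by rewrite pnatr_eq0 -lt0n prime_gt0.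
have [s es] : in_Z_adjoin theta y.
  apply/(mono theta) => //; first exact/rootP.
  split=> //; exists (map_poly intr g), p%:R%:P.
  rewrite map_ratr_intr map_polyC hornerC /= ratr_nat -[(_).[_]]/(zeval theta g) -ey.
  by rewrite mulrC mulKf.
have [|w ew] := zeval_ker mf irr f0 (c := g - p%:R * s).
  by rewrite !zevalE -ey es subrr.
have : red p f %| red p g.
  rewrite -[g](subrK (p%:R * s)) ew rmorphD !rmorphM /= red_p // mul0r addr0.
  exact: dvdp_mulr.
move/dvdp_leq => /(_ g0); rewrite size_red_monic // leqNgt.
by rewrite (leq_ltn_trans (size_poly _ _)).
Qed.

(** Set [y = (R Q)(theta) / p]. Then [y ^ 2 = R(theta) (a - 2 e) / p ^ 2] is
    integral. Since [R] has degree at most [2] and [N > 3], [Q] is not constant,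
    so [R Q] has degree less than [N]. *)
Lemma not_monogenic_of_square_part p N (a e : int) : prime p -> (3 < N)%N ->
  e ^+ 2 = 1 -> (a = 2 * e %[mod p%:Z ^+ 2])%Z -> ~ monogenic (T N - a%:P).
Proof.
move=> pr_p N3 he /eqz_modP[c ec] mono; have N0 : (0 < N)%N by exact: leq_trans N3.
have [R [Q [eRQ [S eS] _]]] := chebyshevT_square_part N he.
have [sf mf] := size_monic_chebyshevT_sub a N0.
have [s2 m2] := size_monic_chebyshevT_sub (2 * e) N0.
have [theta f0] : exists theta, zeval theta (T N - a%:P) = 0.
  by apply: zeval_root_exists; rewrite ?sf.
have np0 : p%:R != 0 :> algC by rewrite pnatr_eq0 -lt0n prime_gt0.
have RQ0 : R * Q ^+ 2 != 0 by rewrite -eRQ monic_neq0.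
have [R0 Q0] : R != 0 /\ Q != 0.
  by move: RQ0; rewrite mulf_eq0 expf_eq0 /= negb_or => /andP.
have sR : (size R <= 3)%N.
  have sX : size ('X ^+ 2 - 4%:P : {poly int})%R = 3%N by rewrite size_XnsubC.
  rewrite -sX -eS; have [S0|S0] := eqVneq S 0.
    by move: sX; rewrite -eS S0 mulr0 size_poly0.
  by rewrite size_mul // -(prednK (_ : 0 < size S)%N) ?size_poly_gt0 // addnS leq_addr.
have sQ : (1 < size Q)%N.
  rewrite ltnNge; apply/negP => sQ.
  have : (size (R * Q ^+ 2)%R <= 3)%N.
    rewrite (size1_polyC sQ) -rmorphXn mulrC mul_polyC.
    exact: leq_trans (size_scale_leq _ _) sR.
  by rewrite -eRQ s2 leqNgt ltnS ltnW.
have sg : (size (R * Q)%R < size (T N - a%:P)%R)%N.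
  rewrite sf -s2 eRQ expr2 mulrA [in X in (_ < X)%N]size_mul ?mulf_neq0 //.
  rewrite -(subnK sQ) addn2 addnS /=; rewrite addnS ltnS leq_addr //.
have rg : red p (R * Q) != 0.
  apply/eqP => h; have := monic_neq0 (monic_red p m2).
  by rewrite eRQ expr2 mulrA rmorphM /= h mul0r eqxx.
pose y := zeval theta (R * Q) / p%:R.
have tA : theta \in Aint by apply/AintP; exists (T N - a%:P).
have yA : y \in Aint.
  apply: (@Aint_root_quadratic y 0 (zeval theta R * c%:~R)).
  - exact: Aint0.
  - by rewrite rpredM ?Aint_int // Aint_zeval.
  rewrite mul0r add0r /y expr_div_n; apply: (canLR (mulfK _)).
    by rewrite expf_neq0.
  have e2 : zeval theta R * zeval theta Q ^+ 2 = p%:R ^+ 2 * c%:~R.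
    rewrite -zevalXn -zevalM -eRQ.
    rewrite (_ : T N - (2 * e)%:P = (T N - a%:P) + (a - 2 * e)%:P); last first.
      by rewrite polyCB; ring.
    by rewrite zevalD f0 add0r zevalC ec intrM rmorphXn.
  by rewrite zevalM -mulrA [c%:~R * _]mulrC -e2; ring.
have := monogenic_no_integral_quotient (y := y) mono f0 pr_p sg rg.
by rewrite yA /y mulrC divfK // => /(_ erefl).
Qed.

(** Write [T_N - a = G g + p v] with [p] dividing [v], and set [x = G(theta)]
    and [y = g(theta) / p]. Then [x y = - v], and [g = G ^ (p - 1)] modulo [p]
    turns this into a monic quadratic equation for [y] with integral
    coefficients. *)
Lemma not_monogenic_of_prime_expansion p N (a : int) :
  prime p -> (p %| N)%N -> (0 < N)%N ->
  ((T p).[a] = a %[mod p%:Z ^+ 2])%Z -> ~ monogenic (T N - a%:P).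
Proof.
move=> pr_p /dvdnP[M ->]; rewrite muln_gt0 => /andP[M0 p0] /eqz_modP[c ec] mono.
have N0 : (0 < M * p)%N by rewrite muln_gt0 M0.
have [v [W [eT ev]]] := chebyshevT_mul_prime_expansion M a pr_p.
have vE : v = p%:Z * c.
  have pz : p%:Z != 0 by move: p0; case: (p).
  by apply: (mulfI pz); rewrite -ev ec; ring.
pose G := T M - a%:P; pose g := G ^+ p.-1 + p%:R * W.
have eg : G * g = T (M * p) - (a + p%:Z * v)%:P.
  have -> : (a + p%:Z * v)%:P = a%:P + p%:R * v%:P :> {poly int}.
    by rewrite polyCD polyCM -[in RHS]polyC_natr natz.
  by apply: (eq_of_subr_eq (esym eT)); rewrite -/G -/g; ring.
have [sf mf] := size_monic_chebyshevT_sub a N0.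
have [s2 m2] := size_monic_chebyshevT_sub (a + p%:Z * v) N0.
have [sG mG] := size_monic_chebyshevT_sub a M0.
have g0 : g != 0.
  by apply/eqP => g0; move: (monic_neq0 m2); rewrite -eg g0 mulr0 eqxx.
have sg : (size g < size (T (M * p) - a%:P)%R)%N.
  rewrite sf -s2 -eg size_mul // ?monic_neq0 // sG addSn /= -[X in (X < _)%N]add0n.
  by rewrite ltn_add2r.
have rg : red p g != 0.
  apply/eqP => h; have := monic_neq0 (monic_red p m2).
  by rewrite -eg rmorphM /= h mulr0 eqxx.
have [theta f0] : exists theta, zeval theta (T (M * p) - a%:P) = 0.
  by apply: zeval_root_exists; rewrite ?sf.
have np0 : p%:R != 0 :> algC by rewrite pnatr_eq0 -lt0n prime_gt0.
have tA : theta \in Aint by apply/AintP; exists (T (M * p) - a%:P).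
pose y := zeval theta g / p%:R.
have ey : p%:R * y = zeval theta g by rewrite mulrC divfK.
pose w := zeval theta W; pose x := zeval theta G.
have exy : x * y = - p%:R * c%:~R.
  apply: (mulfI np0); rewrite mulrCA ey /x -zevalM eg.
  rewrite (_ : T (M * p) - _ = T (M * p) - a%:P - (p%:Z * v)%:P); last first.
    by rewrite polyCD; ring.
  by rewrite zevalD f0 zevalN zevalC vE !intrM; ring.
have yA : y \in Aint.
  apply: (@Aint_root_quadratic y w (- (c%:~R * x ^+ (p - 2)))).
  - exact: Aint_zeval.
  - by rewrite rpredN rpredM ?Aint_int ?rpredX // Aint_zeval.
  apply: (mulfI np0).
  have e1 : p%:R * y = x * x ^+ (p - 2) + p%:R * w.
    rewrite ey /g zevalD zevalXn zevalM zeval_nat -exprS; congr (_ ^+ _ + _).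
    by rewrite -subSn ?prime_gt1 // subSS subn1.
  rewrite expr2 mulrA e1.
  transitivity ((x * y) * x ^+ (p - 2) + p%:R * w * y); first by ring.
  by rewrite exy; ring.
have := monogenic_no_integral_quotient (y := y) mono f0 pr_p sg rg ey.
by rewrite yA.
Qed.

(** * The characterization *)

Theorem theorem4p5 (d : nat) (hd : (2 <= d)%N) (a : int) :
  dynamically_monogenic (chebyshevT d) a <->
  (forall p : nat, prime p -> ~~ (p %| d)%N ->
     ~ (a = 2 %[mod p%:Z ^+ 2])%Z /\ ~ (a = - 2 %[mod p%:Z ^+ 2])%Z) /\
  (forall p : nat, prime p -> (p %| d)%N ->
     ~ ((chebyshevT p).[a] = a %[mod p%:Z ^+ 2])%Z).
Proof.
have d0 : (0 < d)%N by exact: ltnW.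
split=> [mono | [h1 h2] n n1]; last first.
  rewrite poly_iter_chebyshevT; have N0 : (0 < d ^ n)%N by rewrite expn_gt0 d0.
  have h2n p : prime p -> (p %| d ^ n)%N -> ~ ((T p).[a] = a %[mod p%:Z ^+ 2])%Z.
    by move=> pr_p; rewrite Euclid_dvdX // => /andP[/(h2 p pr_p)].
  have [_ mf] := size_monic_chebyshevT_sub a N0.
  apply: monogenic_of_dedekind => // [|p pr_p phi mphi irr].
    exact: chebyshevT_irreducible.
  have [pN|pN] := boolP (p %| d ^ n)%N.
    exact: chebyshevT_dedekind_dvd (h2n p pr_p pN) mphi irr.
  have [|ha hb] := h1 p pr_p; first by move: pN; rewrite Euclid_dvdX // n1 andbT.
  exact: chebyshevT_dedekind_ndvd hb mphi irr.
split=> p pr_p pd; last first.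
  move=> ha; have := mono 1%N isT; rewrite poly_iter_chebyshevT expn1.
  exact: not_monogenic_of_prime_expansion ha.
(* The second iterate is used because its degree exceeds [3] also for [d = 2],
   where [T_2 - 2 = 'X^2 - 4] has no square factor. *)
have m2 := mono 2%N isT; rewrite poly_iter_chebyshevT in m2.
have N3 : (3 < d ^ 2)%N by rewrite (leq_trans (_ : 3 < 2 ^ 2)%N) // leq_exp2r.
split=> ha.
  by apply: (not_monogenic_of_square_part (e := 1) pr_p N3) m2; rewrite ?expr1n ?mulr1.
apply: (not_monogenic_of_square_part (e := -1) pr_p N3) m2.
  by rewrite sqrrN expr1n.
by rewrite mulrN1.
Qed.
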